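(* A Banach space $E$ is the (isometric) dual of a separable Banach space if and only if there exists a countable norming subset $\mathcal F\subset E^*$ such that the closed unit ball $\mathbb B_E$ is $\sigma(E,\mathcal F)$-compact.
   Context: All Banach spaces are real. $E$ is the isometric dual of $E_*$ if $(E_* )^*$ is isometrically isomorphic to $E$. $\mathbb B_E=\{x\in E:\|x\|_E\le 1\}$. A subset $\mathcal F\subset E^*$ is norming for $E$ if $\|x\|_E=\sup_{f\in\mathcal F}|\langle f,x\rangle_E|$ for all $x\in E$. $\sigma(E,\mathcal F)$ is the coarsest topology on $E$ such that all elements of $\mathcal F$ are continuous. *)

(* Defs.v *)
From HB Require Import structures.
From mathcomp Require Import all_boot all_order all_algebra.
From mathcomp Require Import all_classical all_reals all_analysis.

Set Implicit Arguments.
Unset Strict Implicit.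
Unset Printing Implicit Defensive.
Import Order.TTheory GRing.Theory Num.Theory.
Import numFieldNormedType.Exports.

Local Open Scope classical_set_scope.
Local Open Scope ring_scope.

Section dual.
Context {R : realType} (V : normedModType R).

Definition continuous_linear : pred (V -> R^o) :=
  fun f => `[< linear f /\ continuous f >].

Record dual := Dual {
  dual_fun :> V -> R^o;
  dual_funP : dual_fun \in continuous_linear }.

HB.instance Definition _ := [isSub for dual_fun].
HB.instance Definition _ := [Choice of dual by <:].

Fact continuous_linear_submod_closed : submod_closed continuous_linear.
Proof.
split=> [|a f g /asboolP[lf cf] /asboolP[lg cg]]; apply/asboolP; split.
- by move=> a u v; rewrite -[RHS]/(a *: 0 + 0) scaler0 addr0.
- exact: cst_continuous.
- move=> b u v; rewrite -![(a *: f + g) _]/(a *: f _ + g _) lf lg.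
  by rewrite !scalerDr !scalerA (mulrC a) -!addrA; congr (_ + _); rewrite addrCA.
- by move=> x; apply: cvgD; [apply: cvgZr; exact: cf | exact: cg].
Qed.

HB.instance Definition _ :=
  GRing.isSubmodClosed.Build R (V -> R^o) continuous_linear
    continuous_linear_submod_closed.
HB.instance Definition _ := [SubChoice_isSubLmodule of dual by <:].

Lemma dual_linear (f : dual) : linear f.
Proof. by have /asboolP[] := dual_funP f. Qed.

Lemma dual_continuous (f : dual) : continuous f.
Proof. by have /asboolP[] := dual_funP f. Qed.

HB.instance Definition _ (f : dual) :=
  GRing.isLinear.Build R V R^o *:%R f (dual_linear f).

Lemma dualP (f g : dual) : (forall x, f x = g x) -> f = g.
Proof. by move=> fg; apply: val_inj; apply/funext. Qed.

Definition dual_norm (f : dual) : R :=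
  sup [set `|f x| | x in [set x : V | `|x| <= 1]].

Lemma has_sup_dual_norm (f : dual) :
  has_sup [set `|f x| | x in [set x : V | `|x| <= 1]].
Proof.
split; first by exists `|f 0|, 0 => //=; rewrite normr0 ler01.
have : bounded_near f (nbhs (0 : V)).
  by apply/linear_bounded_continuous; exact: dual_continuous.
move=> /bounded_funP /(_ 1)[M fM]; exists M => _ [x /= x1 <-]; exact: fM.
Qed.

Lemma le_dual_norm (f : dual) (x : V) : `|f x| <= dual_norm f * `|x|.
Proof.
have [->|x0] := eqVneq x 0; first by rewrite raddf0 !normr0 mulr0.
rewrite -ler_pdivrMr ?normr_gt0//.
apply: ub_le_sup; first by case: (has_sup_dual_norm f).
exists (`|x|^-1 *: x) => /=.
  by rewrite normrZ normfV normr_id mulVf ?normr_eq0.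
by rewrite linearZ normrZ normfV normr_id mulrC.
Qed.

Lemma dual_norm_le (f : dual) (M : R) :
  (forall x : V, `|x| <= 1 -> `|f x| <= M) -> dual_norm f <= M.
Proof.
move=> fM; apply: ge_sup; first by case: (has_sup_dual_norm f).
by move=> _ [x /= x1 <-]; exact: fM.
Qed.

Fact dual_norm_ge0 (f : dual) : 0 <= dual_norm f.
Proof.
apply: le_trans (normr_ge0 (f 0)) _; apply: ub_le_sup.
  by case: (has_sup_dual_norm f).
by exists 0 => //=; rewrite normr0 ler01.
Qed.

Fact dual_normD (f g : dual) : dual_norm (f + g) <= dual_norm f + dual_norm g.
Proof.
apply: dual_norm_le => x x1; apply: le_trans (ler_normD (f x) (g x)) _.
by apply: lerD; apply: le_trans (le_dual_norm _ x) _;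
  rewrite ler_piMr ?dual_norm_ge0.
Qed.

Let dual_normZ_le (a : R) (f : dual) :
  dual_norm (a *: f) <= `|a| * dual_norm f.
Proof.
apply: dual_norm_le => x x1; rewrite [X in `|X|](_ : _ = a *: f x)//.
rewrite normrZ ler_wpM2l//.
by apply: le_trans (le_dual_norm _ x) _; rewrite ler_piMr ?dual_norm_ge0.
Qed.

Fact dual_normZ (a : R) (f : dual) : dual_norm (a *: f) = `|a| * dual_norm f.
Proof.
apply/eqP; rewrite eq_le dual_normZ_le/=.
have [->|a0] := eqVneq a 0; first by rewrite normr0 mul0r dual_norm_ge0.
rewrite -ler_pdivlMl ?normr_gt0// -normfV.
by rewrite -[X in dual_norm X <= _](scalerK a0) dual_normZ_le.
Qed.

Fact dual_norm0_eq0 (f : dual) : dual_norm f = 0 -> f = 0.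
Proof.
move=> f0; apply: dualP => x; apply/eqP; rewrite -normr_le0.
by rewrite (le_trans (le_dual_norm f x))// f0 mul0r.
Qed.

HB.instance Definition _ := Lmodule_isNormed.Build R dual
  dual_normD dual_normZ dual_norm0_eq0.

Lemma dual_normE (f : dual) :
  `|f| = sup [set `|f x| | x in [set x : V | `|x| <= 1]].
Proof. by []. Qed.

End dual.

Definition isometrically_isomorphic {R : realType} (V W : normedModType R) :=
  exists T : {linear V -> W}, bijective T /\ forall x, `|T x| = `|x|.

Definition isometric_dual {R : realType} (E Estar : normedModType R) :=
  isometrically_isomorphic (dual Estar) E.

Definition separable (T : topologicalType) :=
  exists D : set T, countable D /\ dense D.

(* The supremum is taken in the extended reals: it is +oo for an unbounded
   family of values, where the real [sup] would return 0. *)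
Definition norming {R : realType} {E : normedModType R} (F : set (dual E)) :=
  forall x : E, `|x|%:E = ereal_sup [set `|f x|%:E | f in F].

(* sigma(E, F): the supremum, over f in F, of the initial topologies of f. *)
Definition sigma_topology {R : realType} {E : normedModType R}
    (F : set (dual E)) : topologicalType :=
  sup_topology (fun f : F =>
    Topological.on (initial_topology (dual_fun (val f)))).

Definition unit_ball {R : realType} (E : normedModType R) : set E :=
  [set x | `|x| <= 1].
Arguments unit_ball {R} E.

(* Main.v *)
From HB Require Import structures.
Require Import Defs.
From mathcomp Require Import all_boot all_order all_algebra.
From mathcomp Require Import ring lra.
From mathcomp Require Import all_classical all_reals all_analysis.

(** If [E] is the dual of a separable [V], with countable dense set [D], the
evaluations at the normalized points of [D] form a countable norming family
([norming_eval]), and the ball of [E] is compact for the topology they generate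
because it is weak-star compact: along an ultrafilter all evaluations converge
and the pointwise limit is a functional of norm at most 1 ([alaoglu_ultra]).

Conversely, let the ball of [E] be compact for sigma(E, F) with
[F = {u 0, u 1, ...}] norming.  The predual is the closed linear span [Z] of [F]
in the dual of [E].  It is a Banach space because the dual of [E] is complete,
and it is separable because rational combinations of the [u i] are dense.
Sending [x] to the functional [z |-> z x] on [Z] is isometric because [F] is
norming and contained in the unit ball of [Z] ([pairing_iso]).

The heart of the proof is that this map is onto.  Given [phi] of norm at most 1
on [Z], one needs [x] in the ball of [E] with [u i x = phi (u i)] for all [i].
Finitely many of these equations are solved by minimizing the sum of the
squares [(u i x - phi (u i)) ^ 2] over the compact ball: the first-order
condition at a minimizer, tested on the combination of the [u i] whose
coefficients are the residuals, forces the residuals to vanish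
([finite_moments_attained]).  Compactness then passes from finitely many
equations to all of them ([moments_attained]), and density of the combinations
identifies [x] with [phi]. *)

Set Implicit Arguments.
Unset Strict Implicit.
Unset Printing Implicit Defensive.
Import Order.TTheory GRing.Theory Num.Theory.
Import numFieldNormedType.Exports.

Local Open Scope classical_set_scope.
Local Open Scope ring_scope.

(** * Pointwise limits of functionals, completeness of the dual, Alaoglu *)

Lemma fmap_ultra (T U : Type) (f : T -> U) (G : set_system T) :
  UltraFilter G -> UltraFilter (f @ G).
Proof.
move=> UG; split=> [|H PH GH]; first exact: fmap_proper_filter.
apply/seteqP; split=> // A HA.
have [//|GCA] := in_ultra_setVsetC (f @^-1` A) UG.
have HCA : H (~` A) by exact: GH.
by have [x []] := filter_ex (filterI HA HCA).
Qed.

Section dual_space.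
Context {R : realType} (V : normedModType R).

Lemma bounded_dualP (f : V -> R^o) (M : R) :
  linear f -> (forall v, `|f v| <= M * `|v|) -> f \in @continuous_linear R V.
Proof.
move=> lf fM; apply/asboolP; split=> //.
pose f_lin := GRing.isLinear.Build R V R^o *:%R f lf.
pose fL : {linear V -> R^o} := HB.pack f f_lin.
apply: (@bounded_linear_continuous _ _ _ fL).
apply/linear_boundedP; exists M; split; first exact: num_real.
by move=> r Mr v; apply: le_trans (fM v) _; rewrite ler_wpM2r// ltW.
Qed.

Definition bounded_dual (f : V -> R^o) (M : R) (lf : linear f)
    (fM : forall v, `|f v| <= M * `|v|) : dual V :=
  Dual (bounded_dualP lf fM).

Lemma normr_dual_le (f : dual V) (v : V) : `|f v| <= `|f| * `|v|.
Proof. exact: le_dual_norm. Qed.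

Lemma dual_norm_le_mul (f : dual V) (M : R) : 0 <= M ->
  (forall v, `|f v| <= M * `|v|) -> `|f| <= M.
Proof.
move=> M0 fM; apply: dual_norm_le => v v1.
by apply: le_trans (fM v) _; rewrite ler_piMr.
Qed.

Lemma dual_norm_le_ball (f : dual V) (v : V) : `|v| <= 1 -> `|f v| <= `|f|.
Proof.
by move=> v1; apply: le_trans (normr_dual_le f v) _; rewrite ler_piMr.
Qed.

Lemma dual_evalP (f : dual V) (a : R) (u v : V) :
  f (a *: u + v) = a * (f u : R) + f v :> R.
Proof. exact: dual_linear. Qed.

Lemma dual_sumE (I : Type) (s : seq I) (f : I -> dual V) (v : V) :
  (\sum_(i <- s) f i) v = \sum_(i <- s) f i v.
Proof. by elim/big_rec2: _ => // i x y _ <-. Qed.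

(** Linearity and a uniform norm bound are conditions on finitely many values at
a time, so they pass to pointwise limits.  This one fact gives both the
weak-star compactness of the dual ball and the completeness of the dual. *)
Lemma pointwise_limit_dual (G : set_system (dual V)) (L : V -> R) (M : R) :
    ProperFilter G -> (\forall f \near G, `|f| <= M) ->
    (forall v, (fun f : dual V => f v : R) @ G --> L v) ->
  exists2 g : dual V, `|g| <= M & forall v, g v = L v.
Proof.
move=> PG GM GL.
have M0 : 0 <= M by have [f] := filter_ex GM; apply: le_trans.
have lL : linear (L : V -> R^o).
  move=> a u v.
  have Luv : (fun f : dual V => f (a *: u + v) : R) @ G --> a * L u + L v.
    rewrite (_ : (fun f : dual V => _) = fun f => a * (f u : R) + f v); last first.
      by apply/funext => f; exact: dual_evalP.
    exact: (cvgD (cvgMl_tmp (GL u)) (GL v)).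
  exact: norm_cvg_unique (GL (a *: u + v)) Luv.
have LM v : `|L v| <= M * `|v|.
  have GLv : (fun f : dual V => `|f v : R|) @ G --> `|L v|.
    by move: (GL v) => /(@cvg_norm R R).
  apply: (cvgr_to_le GLv); apply: filterS GM => f fM.
  by apply: le_trans (normr_dual_le f v) _; rewrite ler_wpM2r.
by exists (bounded_dual lL LM) => //; exact: dual_norm_le_mul.
Qed.

(** Weak-star compactness of the dual ball.  Along an ultrafilter the values at
each vector [v] stay between [- `|v|] and [`|v|], hence converge, and the
pointwise limit is again in the ball. *)
Lemma alaoglu_ultra (G : set_system (dual V)) :
    UltraFilter G -> G (@unit_ball R (dual V)) ->
  exists2 g : dual V, `|g| <= 1 & forall v, (fun f : dual V => f v : R) @ G --> g v.
Proof.
move=> UG G1.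
have ev v : exists l : R, (fun f : dual V => f v : R) @ G --> l.
  have := @segment_compact R (- `|v|) (`|v|); rewrite compact_ultra.
  move=> /(_ ((fun f : dual V => f v : R) @ G)) [||l [_ ?]]; last by exists l.
    exact: fmap_ultra.
  rewrite /fmap /=; apply: filterS G1 => f /= f1; rewrite in_itv /= -ler_norml.
  apply: le_trans (normr_dual_le f v) _.
  by rewrite -[leRHS]mul1r ler_wpM2r.
have [L GL] := choice ev.
have [g g1 gL] := pointwise_limit_dual _ G1 GL.
by exists g => // v; rewrite gL.
Qed.

(** The pointwise limit exists because the scalars are complete; it is a norm
limit because the estimate [`|f v - f0 v| <= e * `|v|], valid for all [f] close
to [f0], survives the passage to the limit in [f]. *)
Lemma dual_complete (G : set_system (dual V)) :
  ProperFilter G -> cauchy G -> cvg G.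
Proof.
move=> PG /cauchyP cG.
have {}cG e : 0 < e -> exists f0 : dual V, \forall f \near G, `|f0 - f| < e.
  by move=> /cG [f0 Gf0]; exists f0; move: Gf0; rewrite -ball_normE.
have ev v : exists l : R, (fun f : dual V => f v : R) @ G --> l.
  apply/cvg_ex; apply: cauchy_cvg; apply/cauchyP => e e0.
  have v1 : 0 < `|v| + 1 by rewrite ltr_wpDl.
  have [f0 Gf0] := cG (e / (`|v| + 1)) (divr_gt0 e0 v1).
  exists (f0 v); rewrite -ball_normE /fmap /=; apply: filterS Gf0 => f f0f.
  rewrite /= -[_ - _]/((f0 - f) v); apply: le_lt_trans (normr_dual_le _ v) _.
  apply: (@le_lt_trans _ _ (`|f0 - f| * (`|v| + 1))).
    by apply: ler_wpM2l => //; rewrite lerDl.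
  by rewrite -ltr_pdivlMr.
have [L GL] := choice ev.
have [f1 Gf1] := cG 1 ltr01.
have bG : \forall f \near G, `|f : dual V| <= `|f1| + 1.
  apply: filterS Gf1 => f f1f; rewrite -[f](subKr f1).
  by apply: le_trans (ler_normB _ _) _; rewrite lerD2l ltW.
have [g _ gL] := pointwise_limit_dual PG bG GL.
apply/cvg_ex; exists g; apply/cvgrPdist_le => e e0.
have e2 : 0 < e / 2 by rewrite divr_gt0.
have [f0 Gf0] := cG _ e2.
have gf0 : `|g - f0| <= e / 2.
  apply: dual_norm_le_mul => [|v]; first exact: ltW.
  have Gv : (fun f : dual V => `|(f v : R) - f0 v|) @ G --> `|L v - f0 v|.
    have GLB : (fun f : dual V => (f v : R) - f0 v) @ G --> L v - f0 v.
      by apply: cvgB (GL v) _; exact: cvg_cst.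
    by move: GLB => /(@cvg_norm R R).
  rewrite -[X in `|X|]/((g v : R) - f0 v) gL; apply: (cvgr_to_le Gv).
  apply: filterS Gf0 => f f0f; rewrite distrC -[_ - _]/((f0 - f) v).
  by apply: le_trans (normr_dual_le _ v) _; rewrite ler_wpM2r// ltW.
apply: filterS Gf0 => f f0f.
rewrite -[_ - _](subrKA f0) (splitr e); apply: le_trans (ler_normD _ _) _.
by rewrite lerD// ltW.
Qed.

HB.instance Definition _ := Uniform_isComplete.Build (dual V) dual_complete.
End dual_space.

(** * Convergence for sigma(E, F) *)

Section sigma_topology.
Context {R : realType} {E : normedModType R} (F : set (dual E)).

Lemma sigma_cvgP (G : set_system E) (x : E) : Filter G ->
  (G --> (x : sigma_topology F)) <->
  (forall f : dual E, F f -> (fun y : E => f y : R) @ G --> (f x : R)).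
Proof.
move=> FG; rewrite cvg_sup; split=> [Gx f Ff|Gx [f Ff]].
  have /= Gfx := Gx (SigSub (mem_set Ff)).
  move=> A Afx; apply: (Gfx (f @^-1` A)).
  exact: (@initial_continuous E R^o f x A Afx).
move=> A [_ /= [[B Bop <-] Bfx BA]].
apply: (filterS BA); apply: (Gx f (set_mem Ff) B).
exact: open_nbhs_nbhs.
Qed.

Lemma sigma_continuous (f : dual E) : F f ->
  continuous (fun x : sigma_topology F => f x : R).
Proof.
move=> Ff x; apply: ((@sigma_cvgP (nbhs (x : sigma_topology F)) x _).1 _ f Ff).
exact: cvg_id.
Qed.

End sigma_topology.

(** * The closed linear span of a sequence *)

Lemma approx_dense {R : realType} {V : normedModType R} (D : set V) :
  (forall v e, 0 < e -> exists2 d, D d & `|v - d| < e) -> dense D.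
Proof.
move=> approxD O [v Ov] oO.
have /nbhs_ballP[e /= e0 veO] : nbhs v O by exact: open_nbhs_nbhs.
have [d Dd vd] := approxD v e e0.
by exists d; split=> //; apply: veO; rewrite -ball_normE.
Qed.

Section closed_span.
Context {R : realType} {V : normedModType R} (u : nat -> V).

(** A formal combination is a list of weighted indices, with repetitions allowed,
so that addition is concatenation and no padding of coefficient families is
needed. *)
Definition lincomb (s : seq (R * nat)) : V := \sum_(p <- s) p.1 *: u p.2.

Lemma lincomb_cat s t : lincomb (s ++ t) = lincomb s + lincomb t.
Proof. exact: big_cat. Qed.

Lemma lincomb_cons p s : lincomb (p :: s) = p.1 *: u p.2 + lincomb s.
Proof. exact: big_cons. Qed.

Lemma lincombZ a s : lincomb [seq (a * p.1, p.2) | p <- s] = a *: lincomb s.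
Proof.
by rewrite /lincomb big_map scaler_sumr; apply: eq_bigr => p _; rewrite scalerA.
Qed.

Definition in_closed_span : pred V := fun v =>
  `[< forall e, 0 < e -> exists s, `|v - lincomb s| < e >].

Fact closed_span_submod_closed : submod_closed in_closed_span.
Proof.
split=> [|a v w /asboolP vS /asboolP wS]; apply/asboolP => e e0.
  by exists [::]; rewrite /lincomb big_nil subrr normr0.
have a1 : 0 < `|a| + 1 by rewrite ltr_wpDl.
have [s vs] := vS (e / 2 / (`|a| + 1)) (divr_gt0 (divr_gt0 e0 (ltr0Sn _ _)) a1).
have [t wt] := wS (e / 2) (divr_gt0 e0 (ltr0Sn _ _)).
exists ([seq (a * p.1, p.2) | p <- s] ++ t).
rewrite lincomb_cat lincombZ opprD addrACA -scalerBr (splitr e).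
apply: le_lt_trans (ler_normD _ _) _; rewrite ler_ltD// normrZ.
apply: (@le_trans _ _ ((`|a| + 1) * `|v - lincomb s|)).
  by rewrite ler_wpM2r// lerDl.
by rewrite mulrC -ler_pdivlMr// ltW.
Qed.

HB.instance Definition _ :=
  GRing.isSubmodClosed.Build R V in_closed_span closed_span_submod_closed.

Record closed_span := ClosedSpan {
  span_val :> V;
  span_valP : span_val \in in_closed_span }.

HB.instance Definition _ := [isSub for span_val].
HB.instance Definition _ := [Choice of closed_span by <:].
HB.instance Definition _ := [SubChoice_isSubLmodule of closed_span by <:].

Definition span_norm (z : closed_span) : R := `|span_val z|.

Fact span_normD (x y : closed_span) : span_norm (x + y) <= span_norm x + span_norm y.
Proof. exact: ler_normD. Qed.

Fact span_normZ (a : R) (x : closed_span) : span_norm (a *: x) = `|a| * span_norm x.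
Proof. exact: normrZ. Qed.

Fact span_norm0_eq0 (x : closed_span) : span_norm x = 0 -> x = 0.
Proof. by move=> /normr0_eq0 x0; apply: val_inj. Qed.

HB.instance Definition _ := Lmodule_isNormed.Build R closed_span
  span_normD span_normZ span_norm0_eq0.

Lemma lincomb_in_span s : lincomb s \in in_closed_span.
Proof. by apply/asboolP => e e0; exists s; rewrite subrr normr0. Qed.

Definition span_lincomb s : closed_span := ClosedSpan (lincomb_in_span s).

Lemma span_lincomb_approx (z : closed_span) e : 0 < e ->
  exists s, `|z - span_lincomb s| < e.
Proof. by have /asboolP := span_valP z; apply. Qed.

Lemma span_lincomb_dense : dense (range span_lincomb).
Proof.
apply: approx_dense => z e /(span_lincomb_approx z)[s zs].
by exists (span_lincomb s) => //; exists s.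
Qed.

(** Perturbing the coefficients one at a time.  Together with the density of the
combinations it makes the countably many rational ones dense. *)
Lemma lincomb_rat s e : 0 < e -> exists t : seq (rat * nat),
  `|lincomb s - lincomb [seq (ratr p.1, p.2) | p <- t]| < e.
Proof.
elim: s e => [|[a i] s IH] e e0.
  by exists [::]; rewrite subrr normr0.
have e2 : 0 < e / 2 by rewrite divr_gt0.
have [t st] := IH _ e2.
have u1 : 0 < `|u i| + 1 by rewrite ltr_wpDl.
have d0 : 0 < e / 2 / (`|u i| + 1) by rewrite divr_gt0.
have [] := @dense_rat R (ball a (e / 2 / (`|u i| + 1))).
- by exists a; exact: ballxx.
- exact: ball_open.
move=> x [ax [q _ qx]]; move: ax; rewrite -{x}qx -ball_normE /= => aq.
exists ((q, i) :: t).
rewrite /= !lincomb_cons opprD addrACA -scalerBl (splitr e).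
apply: le_lt_trans (ler_normD _ _) _; rewrite ler_ltD// normrZ.
apply: (@le_trans _ _ (`|a - ratr q| * (`|u i| + 1))).
  by rewrite ler_wpM2l// lerDl.
by rewrite -ler_pdivlMr// ltW.
Qed.

Lemma closed_span_separable : separable closed_span.
Proof.
pose q (t : seq (rat * nat)) := span_lincomb [seq (ratr p.1, p.2) | p <- t].
exists (range q); split.
  exact: card_le_trans (card_image_le _ _) (countableP _).
apply: approx_dense => z e e0.
have e2 : 0 < e / 2 by rewrite divr_gt0.
have [s zs] := span_lincomb_approx z e2.
have [t st] := lincomb_rat s e2.
exists (q t); first by exists t.
rewrite -[_ - _](subrKA (span_lincomb s)) (splitr e).
by apply: le_lt_trans (ler_normD _ _) _; rewrite ltrD.
Qed.

End closed_span.

(** A Cauchy filter converges in the ambient space, and its limit is still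
approximated by combinations. *)
Lemma closed_span_complete {R : realType} {V : completeNormedModType R}
    (u : nat -> V) (G : set_system (closed_span u)) :
  ProperFilter G -> cauchy G -> cvg G.
Proof.
move=> PG /cauchyP cG.
have {}cG e : 0 < e -> exists z : closed_span u, \forall y \near G, `|z - y| < e.
  by move=> /cG [z Gz]; exists z; move: Gz; rewrite -ball_normE.
have : cvg (@span_val R V u @ G).
  apply: cauchy_cvg; apply/cauchyP => e /cG[z Gz].
  by exists (span_val z); rewrite -ball_normE.
move=> /cvg_ex[/= v /cvgrPdist_lt Gv].
have vS : v \in in_closed_span u.
  apply/asboolP => e e0.
  have e2 : 0 < e / 2 by rewrite divr_gt0.
  have [z vz] := filter_ex (Gv _ e2).
  have [s zs] := span_lincomb_approx z e2.
  exists s; rewrite -[_ - _](subrKA (span_val z)) (splitr e).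
  by apply: le_lt_trans (ler_normD _ _) _; rewrite ltrD.
by apply/cvg_ex; exists (ClosedSpan vS); apply/cvgrPdist_lt.
Qed.

HB.instance Definition _ (R : realType) (V : completeNormedModType R)
    (u : nat -> V) :=
  Uniform_isComplete.Build (closed_span u) (@closed_span_complete R V u).

(** * The dual of a separable space *)

Section dual_of_separable.
Context {R : realType} {E V : normedModType R}.

Lemma isometrically_isomorphic_sym :
  isometrically_isomorphic V E -> isometrically_isomorphic E V.
Proof.
move=> [T [[S TK SK] Tiso]].
have Slin : linear S by exact: can2_linear TK SK.
pose S_lin := GRing.isLinear.Build R E V *:%R S Slin.
pose SL : {linear E -> V} := HB.pack S S_lin.
by exists SL; split=> [|x]; [exists T | rewrite -{2}[x]SK Tiso].
Qed.

(** The set of [v] with [r * `|v| < `|f v|] is open, so it is empty as soon as it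
misses a dense set. *)
Lemma dual_norm_le_dense (D : set V) (f : dual V) (r : R) : dense D -> 0 <= r ->
  (forall d, D d -> `|f d| <= r * `|d|) -> `|f| <= r.
Proof.
move=> dD r0 fD; apply: dual_norm_le_mul => // v; rewrite leNgt; apply/negP => rv.
pose g w : R := `|f w : R| - r * `|w|.
have cg : continuous g.
  move=> w; apply: cvgB.
    by move: (@dual_continuous R V f w) => /(@cvg_norm R R^o).
  by apply: cvgMl_tmp; apply: cvg_norm; exact: cvg_id.
have [] := dD (g @^-1` [set t | 0 < t]).
- by exists v; rewrite /= /g subr_gt0.
- by apply: open_comp => [w _|]; [exact: cg | exact: open_gt].
by move=> d [/= + /fD]; rewrite /g subr_gt0 ltNge => /negP.
Qed.

Context (S : {linear E -> dual V}) (Siso : forall x, `|S x| = `|x|).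

Lemma eval_bound (d : V) (x : E) : `|(`|d|^-1 * (S x d : R) : R^o)| <= 1 * `|x|.
Proof.
rewrite mul1r normrM normfV normr_id.
have [->|d0] := eqVneq d 0; first by rewrite normr0 invr0 mul0r.
rewrite mulrC ler_pdivrMr ?normr_gt0// -Siso; exact: normr_dual_le.
Qed.

Lemma eval_linear (d : V) : linear (fun x : E => `|d|^-1 * (S x d : R) : R^o).
Proof.
move=> a x y; rewrite linearP.
rewrite -[X in _ * X]/(a * (S x d : R) + S y d).
by rewrite mulrDr mulrCA.
Qed.

(** Evaluation at [d / `|d|], which for [d = 0] is the zero functional since
[0^-1 = 0].  Normalizing lets an arbitrary dense set serve in place of a dense
subset of the unit ball. *)
Definition normalized_eval (d : V) : dual E :=
  bounded_dual (eval_linear d) (eval_bound d).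

Lemma norming_eval (D : set V) : dense D -> norming (normalized_eval @` D).
Proof.
move=> dD x; apply/le_anti/andP; split; last first.
  apply: ge_ereal_sup => _ [_ [d Dd <-] <-].
  by rewrite lee_fin; have := eval_bound d x; rewrite mul1r.
have [d0 [_ Dd0]] := dD setT (ex_intro _ 0 I) openT.
set A := [set _ | _ in _].
have ubA d : D d -> (`|normalized_eval d x|%:E <= ereal_sup A)%E.
  by move=> Dd; apply: ereal_sup_ubound; exists (normalized_eval d) => //; exists d.
case: (ereal_sup A) ubA => [r||] ubA; last by have := ubA _ Dd0; rewrite leeNy_eq.
  2: by rewrite leey.
rewrite lee_fin -Siso; apply: (dual_norm_le_dense dD).
  by have := ubA _ Dd0; rewrite lee_fin; apply: le_trans.
move=> d Dd; have := ubA _ Dd; rewrite lee_fin.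
rewrite -[X in `|X|]/(`|d|^-1 * (S x d : R)) normrM normfV normr_id.
have [->|d0'] := eqVneq d 0; first by rewrite raddf0 !normr0 !mulr0.
by rewrite mulrC ler_pdivrMr ?normr_gt0.
Qed.

(** Transport of Alaoglu: [S] carries an ultrafilter on the ball of [E] to the
dual ball; the preimage of its weak-star limit there is a limit for every
evaluation functional. *)
Lemma sigma_compact_eval (T : dual V -> E) (D : set V) : cancel T S ->
  @compact (sigma_topology (normalized_eval @` D)) (unit_ball E).
Proof.
move=> TK; rewrite compact_ultra => U UU Uball.
have [|g g1 Ug] := @alaoglu_ultra R V (S @ U) (fmap_ultra S UU).
  by rewrite /fmap /=; apply: filterS Uball => x /=; rewrite /unit_ball /= Siso.
exists (T g); split; first by rewrite /unit_ball /= -Siso TK.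
apply/sigma_cvgP => _ [d Dd <-].
have Ugd : (fun f : dual V => `|d|^-1 * (f d : R)) @ (S @ U) -->
    `|d|^-1 * (g d : R) by apply: cvgMl_tmp; exact: Ug.
by rewrite -[normalized_eval d (T g)]/(`|d|^-1 * (S (T g) d : R)) TK.
Qed.

End dual_of_separable.

(** * Solving moment problems in a compact ball *)

Lemma quadratic_slope_le0 {R : realType} (A K : R) : 0 <= K ->
  (forall t, 0 <= t <= 1 -> t * A *+ 2 <= t ^+ 2 * K) -> A <= 0.
Proof.
move=> K0 AK; rewrite leNgt; apply/negP => A0.
have AK0 : 0 < A + K by rewrite ltr_pwDl.
have t0 : 0 < A / (A + K) by rewrite divr_gt0.
have /AK : 0 <= A / (A + K) <= 1.
  by rewrite ltW//= ler_pdivrMr// mul1r lerDl.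
(* At t = A / (A + K) the right-hand side is at most t * A. *)
rewrite expr2 -mulrA -mulrnAr ler_pM2l//; apply/negP; rewrite -ltNge.
rewrite mulrAC ltr_pdivrMr//; nra.
Qed.

Lemma unit_ball_segment {R : realType} {E : normedModType R} (x y : E) (t : R) :
  `|x| <= 1 -> `|y| <= 1 ->
  0 <= t <= 1 -> `|x + t *: (y - x)| <= 1.
Proof.
move=> x1 y1 /andP[t0 t1].
rewrite (_ : x + _ = (1 - t) *: x + t *: y); last first.
  by rewrite scalerBr scalerBl scale1r addrCA addrC.
have t1' : 0 <= 1 - t by rewrite subr_ge0.
apply: le_trans (ler_normD _ _) _; rewrite !normrZ !ger0_norm//.
have : (1 - t) * `|x| + t * `|y| <= (1 - t) * 1 + t * 1.
  by rewrite lerD// ler_wpM2l.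
by rewrite !mulr1 subrK.
Qed.

Section compact_ball.
Context {R : realType} {E : normedModType R} (F : set (dual E)).
Context (Fcompact : @compact (sigma_topology F) (unit_ball E)).
Context (u : nat -> dual E) (c : nat -> R).
Context (uF : forall i, F (u i)).
Context (uc : forall s, \sum_(p <- s) p.1 * c p.2 <= `|lincomb u s|).

(** Helly's theorem for finitely many functionals, by nearest point instead of
Hahn-Banach.  A point [x0] of the compact ball minimizes the square distance
from the values [u i x] to the targets [c i].  With [a i = c i - u i x0],
minimality along segments makes the functional [sum a_i u_i] attain its maximum
over the ball, hence its norm, at [x0].  The norm hypothesis on [c] then bounds
[sum a_i c_i] by [sum a_i (u_i x0)], that is [sum a_i ^ 2 <= 0]. *)
Lemma finite_moments_attained n :
  exists2 x : E, `|x| <= 1 & forall i, (i < n)%N -> u i x = c i.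
Proof.
pose q (x : sigma_topology F) : R := \sum_(i < n) ((u i x : R) - c i) ^+ 2.
have cq : continuous q.
  apply: continuous_big => [|i _ x]; first exact: add_continuous.
  have cu : (fun x : sigma_topology F => (u i x : R) - c i) @ x -->
      (u i x : R) - c i.
    by apply: cvgB (@sigma_continuous R E F (u i) (uF i) x) _; exact: cvg_cst.
  by apply: cvg_trans (cvgM cu cu); under eq_fun do rewrite expr2.
have [||x0 /set_mem x01 qmin] :=
  @compact_EVT_min (sigma_topology F) R q (unit_ball E) _ Fcompact.
- by exists 0; rewrite /unit_ball /= normr0.
- exact: continuous_subspaceT.
pose a i : R := c i - u i x0.
have slope (y : E) : `|y| <= 1 ->
    \sum_(i < n) a i * (u i y - u i x0 : R) <= 0.
  move=> y1; apply: (@quadratic_slope_le0 _ _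
    (\sum_(i < n) (u i y - u i x0 : R) ^+ 2)).
    by apply: sumr_ge0 => i _; exact: sqr_ge0.
  move=> t t01.
  have := qmin (x0 + t *: (y - x0)) (mem_set (unit_ball_segment x01 y1 t01)).
  rewrite -subr_ge0 => qz; rewrite -subr_ge0; move: qz; congr (_ <= _).
  rewrite /q -sumrB !mulr_sumr -sumrMnl -sumrB; apply: eq_bigr => i _.
  have -> : u i (x0 + t *: (y - x0)) =
      (u i x0 : R) + t * ((u i y : R) - u i x0) :> R.
    by rewrite addrC dual_evalP addrC raddfB.
  by rewrite /a; ring.
pose s := [seq (a (val i), val i) | i <- enum 'I_n].
have sE (h : nat -> R) : \sum_(p <- s) p.1 * h p.2 = \sum_(i < n) a i * h i.
  by rewrite big_map big_enum.
have lE (y : E) : lincomb u s y = \sum_(i < n) a i * (u i y : R) :> R.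
  by rewrite -(sE (fun i => u i y)) /lincomb dual_sumE.
have lx0 (y : E) : `|y| <= 1 -> (lincomb u s y : R) <= lincomb u s x0.
  move=> y1; rewrite !lE -subr_le0 -sumrB; move: (slope y y1); congr (_ <= _).
  by apply: eq_bigr => i _; rewrite mulrBr.
have norm_l : `|lincomb u s| <= (lincomb u s x0 : R).
  apply: dual_norm_le => y y1; rewrite ler_norml lx0// andbT lerNl.
  have := lx0 (- y); rewrite normrN => /(_ y1).
  by rewrite raddfN.
exists x0 => // i ni.
have a0 : \sum_(i < n) a i ^+ 2 = 0.
  apply/eqP; rewrite eq_le sumr_ge0 ?andbT//; last by move=> j _; exact: sqr_ge0.
  have := le_trans (uc s) norm_l; rewrite sE lE -subr_le0 -sumrB; congr (_ <= _).
  by apply: eq_bigr => j _; rewrite -mulrBr expr2.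
have /eqP := psumr_eq0P (fun j _ => sqr_ge0 _) a0 (i := Ordinal ni) isT.
by rewrite sqrf_eq0 subr_eq0 => /eqP.
Qed.

(** All moments at once: a cluster point of solutions of the first [n] equations
solves each equation, because the functionals are continuous for
sigma(E, F). *)
Lemma moments_attained : exists2 x : E, `|x| <= 1 & forall i, u i x = c i.
Proof.
have [x xP] := choice (fun n => let: ex_intro2 x xB xc := finite_moments_attained n
  in ex_intro (fun x : E => `|x| <= 1 /\ forall i, (i < n)%N -> u i x = c i)
    x (conj xB xc)).
have [|y [yB yx]] := @Fcompact (x @ \oo) _.
  by exists 0%N => // n _; case: (xP n).
exists y => // i; apply/eqP; apply: contraT => uyc.
have [||z [/= -> /eqP]//] := yx [set z | u i z = c i] [set z | u i z != c i].
  by exists i.+1 => // n /= ni; case: (xP n) => _ ->.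
apply: (@sigma_continuous R E F (u i) (uF i) y [set t : R | t != c i]).
by apply: open_nbhs_nbhs; split => //; exact: open_neq.
Qed.
End compact_ball.

(** * The predual of a space with a compact ball *)

Section predual.
Context {R : realType} {E : normedModType R}.

(** A norming set is nonempty, as the supremum of the empty set is [-oo] and not
[`|0|]; so its countability gives an enumeration. *)
Lemma norming_enum (F : set (dual E)) : countable F -> norming F ->
  exists u : nat -> dual E, range u = F.
Proof.
move=> /pfcard_geP[F0|[u]] nF.
  by have := nF 0; rewrite F0 image_set0 ereal_sup0.
exists u; apply/seteqP; split=> [_ [n _ <-]|f Ff].
  exact: funS.
by have [n _ <-] := @surj _ _ _ _ u f Ff; exists n.
Qed.

Context (u : nat -> dual E) (u_norming : norming (range u)).

Lemma normr_norming_le i (x : E) : `|u i x| <= `|x|.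
Proof.
rewrite -lee_fin u_norming; apply: ereal_sup_ubound.
by exists (u i) => //; exists i.
Qed.

Let Z := closed_span u.

Lemma pairing_bound (x : E) (z : Z) : `|span_val z x| <= `|x| * `|z|.
Proof. by rewrite mulrC; exact: normr_dual_le. Qed.

Lemma pairing_linear (x : E) : linear (fun z : Z => span_val z x).
Proof. by []. Qed.

Definition pairing (x : E) : dual Z :=
  bounded_dual (pairing_linear x) (pairing_bound x).

Lemma pairing_is_linear : linear pairing.
Proof. by move=> a x y; apply: dualP => z; exact: dual_linear. Qed.

HB.instance Definition _ :=
  GRing.isLinear.Build R E (dual Z) *:%R pairing pairing_is_linear.

(** Each [u i] has norm at most 1, so the norming family already realizes
[`|x|] inside the unit ball of [Z]. *)
Lemma pairing_iso (x : E) : `|pairing x| = `|x|.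
Proof.
apply/le_anti/andP; split.
  by apply: dual_norm_le_mul => // z; exact: pairing_bound.
rewrite -lee_fin u_norming; apply: ge_ereal_sup => _ [_ [i _ <-] <-].
rewrite lee_fin.
have -> : u i = lincomb u [:: (1, i)] by rewrite /lincomb big_seq1 scale1r.
have z1 : `|span_lincomb u [:: (1, i)]| <= 1.
  apply: dual_norm_le_mul => // y; rewrite mul1r /= /lincomb big_seq1 scale1r.
  exact: normr_norming_le.
by have := dual_norm_le_ball (pairing x) z1.
Qed.

Context (u_compact : @compact (sigma_topology (range u)) (unit_ball E)).

(** A functional [phi] of norm at most 1 satisfies the norm hypothesis of the
moment problem with targets [phi (u i)].  A solution [x] agrees with [phi] on
all combinations, hence on their closure. *)
Lemma pairing_surj_ball (phi : dual Z) : `|phi| <= 1 -> exists x, pairing x = phi.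
Proof.
move=> phi1.
pose c i : R := phi (span_lincomb u [:: (1, i)]).
have phi_lincomb s : phi (span_lincomb u s) = \sum_(p <- s) p.1 * c p.2 :> R.
  elim: s => [|p s IH].
    rewrite big_nil (_ : span_lincomb u [::] = 0) ?raddf0//.
    by apply: val_inj; rewrite /= /lincomb big_nil.
  rewrite big_cons -IH -dual_evalP; congr (phi _); apply: val_inj.
  by rewrite /= lincomb_cons [in RHS]/lincomb big_seq1 scale1r.
have [i|s|x _ xc] := moments_attained u_compact (u := u) (c := c).
- by exists i.
- rewrite -phi_lincomb; apply: le_trans (ler_norm _) _.
  apply: le_trans (normr_dual_le phi _) _.
  by rewrite -[leRHS]mul1r; apply: ler_wpM2r.
exists x; apply/eqP; rewrite -subr_eq0 -normr_le0.
apply: (dual_norm_le_dense (@span_lincomb_dense _ _ u)) => // _ [s _ <-].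
rewrite mul0r normr_le0.
rewrite -[X in X == _]/((lincomb u s x : R) - phi (span_lincomb u s)).
rewrite subr_eq0 phi_lincomb /lincomb dual_sumE; apply/eqP.
by apply: eq_bigr => p _; rewrite -xc.
Qed.

Lemma pairing_bij : bijective pairing.
Proof.
have [g gK] : exists g, cancel g pairing.
  suff /choice[g gK] : forall phi, exists x, pairing x = phi by exists g.
  move=> phi; have [->|phi0] := eqVneq phi 0.
    by exists 0; exact: raddf0.
  have [x xphi] : exists x, pairing x = `|phi|^-1 *: phi.
    by apply: pairing_surj_ball; rewrite normrZ normfV normr_id mulVf// normr_eq0.
  exists (`|phi| *: x).
  rewrite -[phi in RHS](scalerKV (_ : `|phi| != 0)) ?normr_eq0//.
  by rewrite -xphi linearZ.
exists g => // x; apply/eqP; rewrite -subr_eq0 -normr_eq0 -pairing_iso.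
by rewrite raddfB /= gK subrr normr0.
Qed.

End predual.

Theorem theorem3p2 (R : realType) (E : completeNormedModType R) :
  (exists Estar : completeNormedModType R,
      separable Estar /\ isometric_dual E Estar)
  <->
  (exists F : set (dual E),
      [/\ countable F, norming F &
          @compact (sigma_topology F) (unit_ball E)]).
Proof.
split.
  move=> [V [[D [cD dD]] /isometrically_isomorphic_sym[S [[T ST TS] Siso]]]].
  exists (normalized_eval Siso @` D); split.
  - exact: card_le_trans (card_image_le _ _) cD.
  - exact: norming_eval.
  - exact: sigma_compact_eval TS.
move=> [F [/norming_enum uF nF cF]]; have [u uE] := uF nF; rewrite -{}uE in nF cF.
exists (closed_span u); split; first exact: closed_span_separable.
apply: isometrically_isomorphic_sym.
exists (pairing u); split; [exact: pairing_bij | exact: pairing_iso].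
Qed.
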